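(* Let $d\ge 1$ be an integer and let $\alpha_1,\dots,\alpha_d$ be real numbers with $\alpha_i>-1$ for all $i\in\{1,2,\dots,d\}$. Then the radius of uniform convexity $r^{uc}(f_{\alpha})$ of the normalized hyper-Bessel function $f_{\alpha}(z)=z\mathcal{J}_{\alpha}(z)$ is the smallest positive root of the equation $$2z^2\mathcal{J}_{\alpha}''(z)+5z\mathcal{J}_{\alpha}'(z)+\mathcal{J}_{\alpha}(z)=0.$$
   Context: Write $\alpha=(\alpha_1,\dots,\alpha_d)$. The normalized hyper-Bessel function is the entire function $$\mathcal{J}_{\alpha}(z)=\sum_{n\ge 0}\frac{(-1)^n}{n!\,(\alpha_1+1)_n\cdots(\alpha_d+1)_n}\left(\frac{z}{d+1}\right)^{n(d+1)},$$ where $(\beta)_0=1$ and $(\beta)_n=\beta(\beta+1)\cdots(\beta+n-1)$ for $n\ge1$. Set $f_{\alpha}(z)=z\mathcal{J}_{\alpha}(z)$. For an analytic function $f$ with $f(0)=f'(0)-1=0$, the radius of uniform convexity is $$r^{uc}(f)=\sup\left\{r>0:\ \operatorname{Re}\left(1+\frac{zf''(z)}{f'(z)}\right)>\left|\frac{zf''(z)}{f'(z)}\right|\ \text{for all } z\in\mathbb{D}_r\right\},\qquad \mathbb{D}_r=\{z\in\mathbb{C}:|z|<r\},$$ where the condition requires $f'(z)\ne0$ on $\mathbb{D}_r$. *)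

(* Defs.v *)
From mathcomp Require Import all_boot all_order all_algebra.
From mathcomp Require Import complex.
From mathcomp Require Import all_classical all_reals all_analysis.

Set Implicit Arguments.
Unset Strict Implicit.
Unset Printing Implicit Defensive.

Import Order.TTheory GRing.Theory Num.Theory.
Import numFieldNormedType.Exports.

Local Open Scope ring_scope.
Local Open Scope complex_scope.
Local Open Scope classical_set_scope.

(* The complex numbers over R as a bare numFieldType: this is what gives them
   their norm topology, and makes derive1 on Cplx R -> Cplx R the complex
   derivative. *)
Notation Cplx R := (R[i] : numFieldType).

Definition pochhammer (R : realType) (b : R) (n : nat) : R :=
  \prod_(k < n) (b + k%:R).

Definition hyper_bessel_coef (R : realType) (d : nat) (alpha : 'I_d -> R)
    (n : nat) : R :=
  (-1) ^+ n / (n`!%:R * \prod_(i < d) pochhammer (alpha i + 1) n).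

Definition hyper_bessel (R : realType) (d : nat) (alpha : 'I_d -> R)
    (z : Cplx R) : Cplx R :=
  limn (series (fun n : nat =>
    (hyper_bessel_coef alpha n)%:C * (z / d.+1%:R) ^+ (n * d.+1) : Cplx R)).

(* The norm and 'Re take values in R[i], where < between real elements is the
   order of R. *)
Definition uniformly_convex_on_disc (R : realType) (f : Cplx R -> Cplx R)
    (r : R) : Prop :=
  forall z : Cplx R, `|z| < r%:C ->
    derive1 f z != 0 /\
    `|z * derive1n 2 f z / derive1 f z| < 'Re (1 + z * derive1n 2 f z / derive1 f z).

Definition radius_uniform_convexity (R : realType) (f : Cplx R -> Cplx R) :
    \bar R :=
  ereal_sup [set r%:E | r in [set r : R |
    0 < r /\ uniformly_convex_on_disc f r]].

Definition smallest_positive_root (R : realType) (F : Cplx R -> Cplx R)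
    (r : R) : Prop :=
  [/\ 0 < r, F r%:C = 0 & forall s : R, 0 < s -> F s%:C = 0 -> r <= s].

(* Main.v *)
Require Import Defs.
From mathcomp Require Import all_boot all_order all_algebra.
From mathcomp Require Import complex.
From mathcomp Require Import all_classical all_reals all_analysis.
From mathcomp Require Import ring lra.

(** With [D = d + 1] and [w = z ^ D], write [f'(z) = g(w)], so that
    [z f''(z) = D w g'(w)] and the equation of the theorem reads [G(w) = 0] with
    [G = g + 2 D w g']. By Laguerre's argument [g] is a limit of polynomials
    [\prod_t (1 - t w)] with all [t > 0]: replacing such a polynomial [p] by
    [p + b w p'], [b > 0], gives one of the same kind, it multiplies the
    coefficient of [w ^ n] by [1 + n b], and [1 / (a)_n] is, up to scaling, a
    limit of products of such multipliers. For such products one has, below the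
    smallest zero and for [|w| <= rho], [p(rho) <= |p(w)|] and
    [|w p'(w) / p(w)| <= - rho p'(rho) / p(rho)]. These bounds pass to the
    limit, so on the disc [|z| <= r] the worst point is [z = r], where uniform
    convexity reads [G(r ^ D) > 0]. Finally [G] has a positive zero: otherwise
    [g > 0] on the positive reals, so the largest [t] tends to [0], and so does
    [\sum t ^ 2], whose limit is [g_1 ^ 2 - 2 g_2 > 0], where [g_n] is the
    coefficient of [w ^ n] in [g]. *)

Import Order.TTheory GRing.Theory Num.Theory.
Import numFieldNormedType.Exports.

Local Open Scope ring_scope.
Local Open Scope classical_set_scope.

(** * Polynomials with constant term 1 and positive zeros *)

Section Poly.
Context {C : numClosedFieldType}.
Implicit Types (s : seq C) (p : {poly C}) (t w z b c : C).

(** The list holds the reciprocals of the zeros: the constant term is 1, and a zero escaping to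
    infinity is an entry tending to 0. *)
Definition recip_prod s : {poly C} := \prod_(t <- s) (1 - t *: 'X).

Lemma recip_prod_cons t s :
  recip_prod (t :: s) = (1 - t *: 'X) * recip_prod s.
Proof. by rewrite /recip_prod big_cons. Qed.

Lemma recip_prod_cons_horner t s z :
  (recip_prod (t :: s)).[z] = (1 - t * z) * (recip_prod s).[z].
Proof. by rewrite recip_prod_cons hornerM !hornerE. Qed.

Lemma recip_prod_cons_deriv t s z : (recip_prod (t :: s))^`().[z]
  = - t * (recip_prod s).[z] + (1 - t * z) * (recip_prod s)^`().[z].
Proof.
rewrite recip_prod_cons derivM hornerD !hornerM derivB derivZ derivX.
by rewrite -[1]/(1%:P) derivC !hornerE.
Qed.

Lemma recip_prod0 s : (recip_prod s).[0] = 1.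
Proof.
rewrite /recip_prod horner_prod big1 // => t _.
by rewrite !hornerE ?mulr0 ?subr0.
Qed.

(** Newton's identity: the sum of squares is read off two coefficients, hence survives a
    coefficientwise limit. *)
Lemma recip_prod_coefs s :
  (recip_prod s)`_0 = 1 /\ (recip_prod s)`_1 = - \sum_(t <- s) t /\
  (recip_prod s)`_1 ^+ 2 - 2 * (recip_prod s)`_2 = \sum_(t <- s) t ^+ 2.
Proof.
elim: s => [|t s [IH0 [IH1 IH2]]].
  by rewrite /recip_prod !big_nil !coef1 /= oppr0 mulr0 subr0 expr0n.
have E n : (recip_prod (t :: s))`_n.+1
    = (recip_prod s)`_n.+1 - t * (recip_prod s)`_n.
  by rewrite recip_prod_cons mulrBl mul1r -scalerAl coefB coefZ coefXM.
split.
  rewrite recip_prod_cons mulrBl mul1r -scalerAl coefB coefZ coefXM /=.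
  by rewrite mulr0 subr0.
rewrite !E !big_cons -IH2 IH1 IH0; split; first by ring.
by ring.
Qed.

(** Induction on the factors: one factor satisfies 1 - t rho <= |1 - t w|, and logarithmic
    derivatives add. The last bound is multiplied out so that it passes to limits without
    division. *)
Lemma recip_prod_disc s rho w :
    {in s, forall t, 0 < t /\ t * rho < 1} -> 0 <= rho -> `|w| <= rho ->
  let p := recip_prod s in
  [/\ 0 < p.[rho], p.[rho] <= `|p.[w]|, 0 <= - (rho * p^`().[rho]) &
      `|w * p^`().[w]| * p.[rho] <= - (rho * p^`().[rho]) * `|p.[w]| ].
Proof.
move=> + rho0 wrho /=; elim: s => [_|t s IH st].
  rewrite /recip_prod big_nil -[1]/(1%:P) derivC !hornerE ?mulr0 oppr0 normr0.
  by rewrite normr1 ?mul0r.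
have [t0 trho] := st t (mem_head t s).
have [|p0 pw dp0 dpw] := IH.
  by move=> u us; apply: st; rewrite in_cons us orbT.
rewrite !recip_prod_cons_horner !recip_prod_cons_deriv.
set q := recip_prod s in p0 pw dp0 dpw *.
have A : 0 < 1 - t * rho by rewrite subr_gt0.
have B : 1 - t * rho <= `|1 - t * w|.
  apply: le_trans (lerB_dist _ _).
  by rewrite normr1 normrM (gtr0_norm t0) lerD2l lerN2 ler_pM2l.
have E : - (rho * (-t * q.[rho] + (1 - t * rho) * q^`().[rho]))
  = t * rho * q.[rho] + (1 - t * rho) * (- (rho * q^`().[rho])) by ring.
rewrite E; split.
- exact: mulr_gt0.
- by rewrite normrM ler_pM// ltW.
- by apply: addr_ge0; rewrite !mulr_ge0// ltW.
have -> : w * (- t * q.[w] + (1 - t * w) * q^`().[w])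
  = - (t * w * q.[w]) + (1 - t * w) * (w * q^`().[w]) by ring.
apply: (@le_trans _ _ ((t * `|w| * `|q.[w]| +
    `|1 - t * w| * `|w * q^`().[w]|) * ((1 - t * rho) * q.[rho]))).
  apply: ler_wpM2r; first by rewrite mulr_ge0 // ltW.
  by rewrite (le_trans (ler_normD _ _))// normrN !normrM (gtr0_norm t0).
(* The term from the new factor uses |w| (1 - t rho) <= rho |1 - t w|; the other one is the
   induction hypothesis, scaled. *)
rewrite [`|(1 - t * w) * q.[w]|]normrM !mulrDl; apply: lerD.
  rewrite [leLHS](_ : _ = (t * q.[rho] * `|q.[w]|) *
    (`|w| * (1 - t * rho))); last by ring.
  rewrite [leRHS](_ : _ = (t * q.[rho] * `|q.[w]|) *
    (rho * `|1 - t * w|)); last by ring.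
  apply: ler_wpM2l; first by rewrite !mulr_ge0 // ltW.
  by apply: ler_pM => //; exact: ltW.
rewrite [leLHS](_ : _ = ((1 - t * rho) * `|1 - t * w|) *
  (`|w * q^`().[w]| * q.[rho])); last by ring.
rewrite [leRHS](_ : _ = ((1 - t * rho) * `|1 - t * w|) *
  (- (rho * q^`().[rho]) * `|q.[w]|)); last by ring.
by apply: ler_wpM2l => //; rewrite mulr_ge0 // ltW.
Qed.

(** Each summand is - t z / (1 - t z), in a form where z occurs once, which eases the arguments on
    conjugates and signs. *)
Lemma recip_prod_logderiv s z : (recip_prod s).[z] != 0 ->
  z * (recip_prod s)^`().[z]
    = (recip_prod s).[z] * \sum_(t <- s) (1 - (1 - t * z)^-1).
Proof.
elim: s => [_|t s IH].
  by rewrite /recip_prod !big_nil -[1]/(1%:P) derivC !hornerE ?mulr0.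
rewrite recip_prod_cons_horner recip_prod_cons_deriv big_cons mulf_eq0.
rewrite negb_or => /andP[h1 h2].
have -> : z * (- t * (recip_prod s).[z] + (1 - t * z) * (recip_prod s)^`().[z])
  = - t * z * (recip_prod s).[z] + (1 - t * z) * (z * (recip_prod s)^`().[z])
  by ring.
rewrite IH //; set u := \sum_(_ <- _) _.
by field.
Qed.

(** Take the inverses of the roots: X - z = - z (1 - X / z), and p(0) = 1 forces the remaining
    scalar to be 1. *)
Lemma recip_prod_of_roots p : p.[0] = 1 -> (forall z, root p z -> 0 < z) ->
  exists2 s, {in s, forall t, 0 < t} & p = recip_prod s.
Proof.
have [r pE] := closed_field_poly_normal p.
move=> p01 proot; have lc0 : lead_coef p != 0.
  rewrite lead_coef_eq0; apply: contra_eq_neq p01 => ->.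
  by rewrite horner0 eq_sym oner_eq0.
have r0 : {in r, forall z, 0 < z}.
  by move=> z zr; apply: proot; rewrite pE rootZ // root_prod_XsubC.
exists [seq z^-1 | z <- r].
  by move=> t /mapP[z zr ->]; rewrite invr_gt0 r0.
have E : \prod_(z <- r) ('X - z%:P)
    = (\prod_(z <- r) (- z)) *: recip_prod [seq z^-1 | z <- r].
  rewrite /recip_prod big_map -mul_polyC rmorph_prod -big_split /=.
  apply: eq_big_seq => z /r0 z0.
  rewrite mul_polyC scalerBr scalerA mulNr divff ?gt_eqF // scaleN1r opprK.
  by rewrite -mul_polyC mulr1 polyCN addrC.
move: (lead_coef p) pE p01 => c ->.
by rewrite E scalerA hornerZ recip_prod0 mulr1 => ->; rewrite scale1r.
Qed.

(* A zero [z] of [p + b X p'] with [p z != 0] satisfies [S = - 1 / b], where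
   [S = \sum_t (1 - 1 / (1 - t z))]. As [S - S^*] is a negative multiple of
   [z - z^*], [z] is real; and [z < 0] would make [S] nonnegative. *)
Lemma recip_prod_euler s b : {in s, forall t, 0 < t} -> 0 < b ->
  exists2 s', {in s', forall t, 0 < t} &
    recip_prod s + b *: ('X * (recip_prod s)^`()) = recip_prod s'.
Proof.
move=> s0 b0; apply: recip_prod_of_roots.
  by rewrite hornerD hornerZ hornerM hornerX recip_prod0 mul0r mulr0 addr0.
set p := recip_prod s => z; rewrite /root hornerD hornerZ hornerM hornerX => pz.
have [pz0|pz0] := eqVneq p.[z] 0.
  move: pz0; rewrite /p /recip_prod horner_prod => /eqP.
  rewrite prodf_seq_eq0 => /hasP[t ts] /=.
  rewrite (_ : _.[z] = 1 - t * z) ?hornerE // subr_eq0 => /eqP tz.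
  have t0 := s0 _ ts.
  have -> : z = t^-1.
    by apply: (mulfI (lt0r_neq0 t0)); rewrite -tz divff ?gt_eqF.
  by rewrite invr_gt0.
have nz : {in s, forall t, 1 - t * z != 0}.
  move=> t ts; apply: contraNneq pz0 => tz.
  rewrite /p /recip_prod horner_prod prodf_seq_eq0; apply/hasP; exists t => //.
  by rewrite /= !hornerE tz.
set S := \sum_(t <- s) (1 - (1 - t * z)^-1).
have bS : 1 + b * S = 0.
  apply: (mulfI pz0); rewrite mulr0 mulrDr mulr1 mulrCA.
  by rewrite -recip_prod_logderiv //; apply/eqP.
have SE : S = - b^-1.
  apply: (mulfI (lt0r_neq0 b0)); rewrite mulrN divff ?gt_eqF //.
  by apply/eqP; rewrite -addr_eq0 addrC bS.
have S_neq0 : S != 0 by rewrite SE oppr_eq0 invr_eq0 gt_eqF.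
have s_neq0 : s != [::].
  by apply: contraNneq S_neq0 => s_nil; rewrite /S s_nil big_nil.
have conjS : S - S^* = - (z - z^*) * \sum_(t <- s) t / `|1 - t * z| ^+ 2.
  rewrite /S rmorph_sum -sumrB big_distrr /=; apply: eq_big_seq => t ts.
  have t_real : t^* = t by apply: conj_Creal; rewrite ger0_real // ltW // s0.
  have u0 := nz _ ts.
  have uJ : (1 - t * z)^* = 1 - t * z^*.
    by rewrite rmorphB rmorphM rmorph1 /= t_real.
  have uc0 : 1 - t * z^* != 0 by rewrite -uJ conjC_eq0.
  rewrite rmorphB fmorphV rmorph1 /= normCK uJ.
  by field; rewrite u0 uc0.
have sum_gt0 : 0 < \sum_(t <- s) t / `|1 - t * z| ^+ 2.
  case: s s_neq0 s0 nz {p pz pz0 S bS SE S_neq0 conjS} => // t s _ s0 nz.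
  rewrite big_cons ltr_pwDl //.
    apply: divr_gt0; first exact: s0 (mem_head _ _).
    by apply: exprn_gt0; rewrite normr_gt0 nz ?mem_head.
  rewrite big_seq sumr_ge0 // => u us.
  by apply: divr_ge0; rewrite ?exprn_ge0 // ltW // s0 // in_cons us orbT.
have zr : z \is Num.real.
  rewrite CrealE eq_sym -subr_eq0 -oppr_eq0.
  rewrite -(mulIr_eq0 _ (mulIf (lt0r_neq0 sum_gt0))) -conjS SE.
  rewrite rmorphN fmorphV /= (conj_Creal (ger0_real (ltW b0))) subrr eqxx //.
have z0 : z != 0.
  apply: contraNneq S_neq0 => z0.
  by rewrite /S z0 big1 // => t _; rewrite mulr0 subr0 invr1 subrr.
rewrite lt_def z0 /= real_leNgt // ?ger0_real //; apply/negP => zlt0.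
have : 0 <= S.
  rewrite /S big_seq sumr_ge0 // => t ts; rewrite subr_ge0.
  have tz : 0 <= - (t * z).
    rewrite -mulrN; apply: mulr_ge0; first exact: ltW (s0 _ ts).
    by rewrite oppr_ge0 ltW.
  by rewrite invf_le1 ?lerDl // (lt_le_trans ltr01) ?lerDl.
by rewrite SE oppr_ge0 invr_le0 real_leNgt ?b0 // ?ger0_real // ltW.
Qed.

(** Start from (1 - c X)^N and apply [recip_prod_euler] once for each b in [L]: adding b X p'
    multiplies the coefficient of X^n by 1 + n b. *)
Lemma recip_prod_multiplier N c (L : seq C) :
    0 < c -> {in L, forall b, 0 < b} ->
  exists2 s, {in s, forall t, 0 < t} &
    forall n, (recip_prod s)`_n
      = (-1) ^+ n * 'C(N, n)%:R * c ^+ n * \prod_(b <- L) (1 + n%:R * b).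
Proof.
move=> c0; elim: L => [_|b L IH bL].
  exists (nseq N c) => [t|n].
    by rewrite mem_nseq => /andP[_ /eqP ->].
  rewrite big_nil mulr1 /recip_prod big_nseq iter_mulr_1.
  have -> : (1 - c *: 'X) ^+ N =
      \sum_(i < N.+1) ((-1) ^+ i * 'C(N, i)%:R * c ^+ i) *: 'X^i :> {poly C}.
    rewrite exprDn; apply: eq_bigr => i _.
    rewrite expr1n mul1r -scaleNr exprZn [(- c) ^+ i]exprNn scalerMnl.
    by rewrite -mulr_natr mulrAC.
  rewrite -(poly_def N.+1 (fun i => (-1) ^+ i * 'C(N, i)%:R * c ^+ i)).
  rewrite coef_poly ltnS; case: leqP => // nN.
  by rewrite bin_small // mulr0 mul0r.
have [|s s0 sE] := IH; first by move=> x xL; apply: bL; rewrite in_cons xL orbT.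
have [s' s'0 E] := recip_prod_euler s b s0 (bL b (mem_head _ _)).
exists s' => // n; rewrite -E coefD coefZ coefXM coef_deriv big_cons.
case: n => [|n] /=; first by rewrite mulr0 addr0 mul0r addr0 mul1r sE.
by rewrite sE -[_ *+ n.+1]mulr_natl; ring.
Qed.
End Poly.

(** * Termwise differentiation of power series *)

Section Deriv.
Context {K : numFieldType}.
Implicit Types (z h r : K).

(** The left side is one term of the binomial expansion of the right side. *)
Lemma natr_expr_le r e : 0 <= r -> e%:R * r ^+ e.-1 <= (1 + r) ^+ e.
Proof.
move=> r0; elim: e => [|e IH]; first by rewrite mul0r expr0 ler01.
rewrite /= [leRHS]exprS [leRHS]mulrDl mul1r.
rewrite mulr_natl mulrS -mulr_natl.
apply: lerD; first by rewrite lerXn2r ?nnegrE ?addr_ge0 ?ler01 // lerDr.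
apply: le_trans _ (ler_wpM2l r0 IH).
by case: e {IH} => [|e] /=; [rewrite !mul0r mulr0 | rewrite mulrCA -exprS].
Qed.

(** The factor (1 + r)^e is crude, but it is a pure power, so these bounds can be summed against the
    coefficients of an entire series. *)
Lemma expr_taylor1 z h e r : `|z| + `|h| <= r ->
  `|(z + h) ^+ e - z ^+ e - h * (e%:R * z ^+ e.-1)| <= `|h| ^+ 2 * (1 + r) ^+ e.
Proof.
move=> zhr; have r0 : 0 <= r by apply: le_trans zhr; rewrite addr_ge0.
have zr : `|z| <= r by apply: le_trans zhr; rewrite lerDl.
elim: e => [|e IH].
  by rewrite !expr0 subrr mul0r mulr0 subr0 normr0 mulr1 exprn_ge0.
have -> : (z + h) ^+ e.+1 - z ^+ e.+1 - h * (e.+1%:R * z ^+ e) =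
    (z + h) * ((z + h) ^+ e - z ^+ e - h * (e%:R * z ^+ e.-1)) +
    h ^+ 2 * (e%:R * z ^+ e.-1).
  rewrite !exprS -[e.+1]addn1 natrD.
  by case: e {IH} => [|e] /=; rewrite ?expr0 ?exprS; ring.
apply: le_trans (ler_normD _ _) _.
rewrite (exprS (1 + r)) [X in _ <= _ * X]mulrDl mul1r [leRHS]mulrDr addrC.
apply: lerD.
  rewrite normrM normrX ler_wpM2l ?exprn_ge0 //.
  rewrite normrM normr_nat normrX; apply: le_trans _ (natr_expr_le r e r0).
  by rewrite ler_wpM2l // lerXn2r ?nnegrE.
rewrite normrM [leRHS]mulrCA; apply: ler_pM => //.
exact: le_trans (ler_normD _ _) zhr.
Qed.

Lemma cvg_norm_le (N0 : nat) (u : nat -> K) l M :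
  u @ \oo --> l -> (forall n, (N0 <= n)%N -> `|u n| <= M) -> `|l| <= M.
Proof.
move=> ul uM; apply/ler_addgt0Pr => e e0.
have /cvgrPdist_lt/(_ _ e0)[N _ HN] := ul.
rewrite -[l](subrK (u (maxn N0 N))) (le_trans (ler_normD _ _)) // addrC.
by rewrite lerD ?uM ?leq_maxl // ltW // HN //= leq_maxr.
Qed.

(** Nonnegativity of l is the equation |l| = l, which passes to limits for the partial order of the
    complex numbers too. *)
Lemma cvg_ge0 (N0 : nat) (u : nat -> K) l :
  u @ \oo --> l -> (forall n, (N0 <= n)%N -> 0 <= u n) -> 0 <= l.
Proof.
move=> ul u0; rewrite -[l](_ : `|l| = l) ?normr_ge0 //.
apply/eqP; rewrite -subr_eq0 -normr_eq0; apply/eqP/le_anti.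
rewrite normr_ge0 andbT; apply: (@cvg_norm_le N0 (fun n => `|u n| - u n)).
  by apply: cvgB => //; exact: cvg_norm.
by move=> n /u0 un; rewrite (ger0_norm un) subrr normr0.
Qed.

(** Summing [expr_taylor1] bounds the first-order remainder by M |h|^2 for |h| <= 1. A general field
    serves the real and the complex derivative at once. *)
Lemma is_derive_series (a : nat -> K) (e : nat -> nat) (F F1 : K -> K) z :
    (forall z, series (fun n => a n * z ^+ e n) @ \oo --> F z) ->
    series (fun n => a n * (e n)%:R * z ^+ (e n).-1) @ \oo --> F1 z ->
    (forall r, 0 <= r ->
       exists M, forall n, \sum_(k < n) `|a k| * r ^+ e k <= M) ->
  is_derive z 1 F (F1 z).
Proof.
move=> hF hF1 hB.
(* For |h| <= 1, [expr_taylor1] is used with r = |z| + 1, and its bound is a power of 1 + r. *)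
have r0 : 0 <= 1 + (`|z| + 1) by rewrite !addr_ge0.
have [M HM] := hB _ r0.
have M0 : 0 <= M by have := HM 0; rewrite big_ord0.
have key h : `|h| <= 1 -> `|F (z + h) - F z - h * F1 z| <= `|h| ^+ 2 * M.
  move=> h1; apply: (@cvg_norm_le 0 (fun n =>
    series (fun n => a n * (z + h) ^+ e n) n
    - series (fun n => a n * z ^+ e n) n
    - h * series (fun n => a n * (e n)%:R * z ^+ (e n).-1) n)).
    by apply: cvgB; [apply: cvgB|apply: cvgMl_tmp].
  move=> n _; rewrite /series /= !big_mkord mulr_sumr -!sumrB.
  apply: le_trans (ler_norm_sum _ _ _) _.
  apply: le_trans _ (ler_wpM2l _ (HM n)); last by rewrite exprn_ge0.
  rewrite mulr_sumr; apply: ler_sum => k _.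
  rewrite [X in `|X|](_ : _ = a k * ((z + h) ^+ e k - z ^+ e k
     - h * ((e k)%:R * z ^+ (e k).-1))); last by ring.
  rewrite normrM [leRHS]mulrCA ler_wpM2l //.
  by apply: expr_taylor1; rewrite lerD2l.
have cv : (fun h => h^-1 *: (F (h *: 1 + z) - F z)) @ 0^' --> F1 z.
  apply/cvgrPdist_lt => eps eps0.
  (* The denominator is M + 1 because M may be 0. *)
  have d0 : 0 < eps / (M + 1) by rewrite divr_gt0 // ltr_wpDl.
  rewrite near_withinE.
  near=> h => h0.
  have h1 : `|h| <= 1.
    near: h; apply/nbhs_ballP; exists 1 => //= y.
    by rewrite -ball_normE /= sub0r normrN => /ltW.
  have hd : `|h| < eps / (M + 1).
    near: h; apply/nbhs_ballP; exists (eps / (M + 1)) => //= y.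
    by rewrite -ball_normE /= sub0r normrN.
  rewrite -[h *: 1]/(h * 1) mulr1 [h + z]addrC -[_ *: _]/(_ * _).
  have -> : F1 z - h^-1 * (F (z + h) - F z)
      = - (h^-1 * (F (z + h) - F z - h * F1 z)).
    by rewrite (mulrBr _ (F (z + h) - F z)) mulKf // opprB.
  rewrite normrN normrM normfV.
  apply: (@le_lt_trans _ _ (`|h| * M)).
    rewrite ler_pdivrMl ?normr_gt0 // mulrA -expr2; exact: key.
  apply: (@le_lt_trans _ _ (`|h| * (M + 1))).
    by rewrite ler_wpM2l // lerDl.
  by rewrite -ltr_pdivlMr // ltr_wpDl.
split; first by apply/cvg_ex; exists (F1 z).
exact: cvg_lim.
Unshelve. all: by end_near.
Qed.

End Deriv.

(** * Real and complex power series with factorially decaying coefficients *)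

Section Series.
Context {R : realType}.
Local Notation C := (Cplx R).
Implicit Types (b : nat -> R) (e : nat -> nat) (x r : R) (z : C).

Lemma is_cvg_series_abs (u : nat -> R) (M : R) :
  (forall n, \sum_(k < n) `|u k| <= M) -> cvgn (series u).
Proof.
move=> uM.
suff h : cvgn (series (fun n => `|u n|)) by exact: (@normed_cvg _ R^o).
apply: nondecreasing_is_cvgn; last first.
  exists M => _ [n _ <-] /=; rewrite seriesEord /=. exact: uM.
apply: (@nondecreasing_series R (fun n => `|u n|) xpredT 0) => *.
exact: normr_ge0.
Qed.

Lemma norm_real_complex x : `|x%:C%C| = `|x|%:C%C :> R[i].
Proof. by rewrite normc_def /= expr0n /= addr0 sqrtr_sqr. Qed.

Lemma gt0_real_complex (eps : R[i]) :
  0 < eps -> exists2 d : R, 0 < d & eps = d%:C%C.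
Proof. by case: eps => d y; rewrite ltcE /= => /andP[/eqP -> ?]; exists d. Qed.

Lemma ge0_real_complex (t : R[i]) :
  0 <= t -> exists2 x : R, 0 <= x & t = x%:C%C.
Proof.
by case: t => x y; rewrite lecE /= => /andP[/eqP -> x0]; exists x.
Qed.

Lemma cvg_real_complex (u : nat -> R) (l : R) :
  u @ \oo --> l -> (fun n => (u n)%:C%C : C) @ \oo --> (l%:C%C : C).
Proof.
move=> /cvgrPdist_lt ul; apply/cvgrPdist_lt => eps /gt0_real_complex[d d0 ->].
have [N _ HN] := ul _ d0; exists N => // n /HN /= h.
by rewrite -rmorphB norm_real_complex ltcR.
Qed.

Lemma Re_norm_le (z : R[i]) : `|complex.Re z|%:C%C <= `|z|.
Proof.
rewrite normc_def lecR -sqrtr_sqr ler_wsqrtr //.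
by rewrite lerDl sqr_ge0.
Qed.

Lemma Im_norm_le (z : R[i]) : `|complex.Im z|%:C%C <= `|z|.
Proof.
rewrite normc_def lecR -sqrtr_sqr ler_wsqrtr //.
by rewrite lerDr sqr_ge0.
Qed.

Lemma is_cvg_series_complex (u : nat -> C) (M : R) :
  (forall n, \sum_(k < n) `|u k| <= M%:C%C) -> cvgn (series u).
Proof.
move=> uM.
have cv (f : R[i] -> R) : (forall z, `|f z|%:C%C <= `|z|) ->
    cvgn (series (fun n => f (u n))).
  move=> fz; apply: (@is_cvg_series_abs _ M) => n.
  rewrite -lecR rmorph_sum /=; apply: le_trans (uM n).
  by apply: ler_sum => k _; exact: fz.
have cR := cvg_real_complex _ _ (cv _ Re_norm_le).
have cI := cvg_real_complex _ _ (cv _ Im_norm_le).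
apply/cvg_ex; eexists.
rewrite (_ : series u = fun n => (series (fun n => complex.Re (u n)) n)%:C%C
   + 'i%C * (series (fun n => complex.Im (u n)) n)%:C%C).
  apply: cvgD; first exact: cR.
  by apply: cvgMl_tmp; exact: cI.
apply/funext => n; rewrite /series /= !rmorph_sum /= mulr_sumr -big_split /=.
by apply: eq_bigr => k _; exact: complexE.
Qed.

(** Coefficients of an entire function of at most exponential growth, a class stable under weights
    polynomial in n and under rescaling. *)
Definition exp_dominated b := exists A q, [/\ 0 <= A, 0 <= q &
  forall n, `|b n| <= A * (q ^+ n / n`!%:R)].

Lemma exp_sum_le x n : 0 <= x -> \sum_(k < n) x ^+ k / k`!%:R <= expR x.
Proof.
move=> x0.
have := @nondecreasing_cvgn_le R (series (exp_coeff x)) _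
  (is_cvg_series_exp_coeff x) n.
rewrite /series /= big_mkord; apply; apply: nondecreasing_series => k _ _.
exact: exp_coeff_ge0.
Qed.

(** Exponents of at most linear growth cover w^n, z^(n D) and the shifts made by differentiation.
    The comparison is with the exponential series at q (1 + r)^D. *)
Lemma exp_dominated_sum b e D j r : exp_dominated b ->
    (forall n, e n <= n * D + j)%N -> 0 <= r ->
  exists M, forall n, \sum_(k < n) `|b k| * r ^+ e k <= M.
Proof.
move=> [A [q [A0 q0 bA]]] eD r0.
exists (A * (1 + r) ^+ j * expR (q * (1 + r) ^+ D)) => n.
have r1 : 0 <= 1 + r by rewrite addr_ge0.
have qr0 : 0 <= q * (1 + r) ^+ D by rewrite mulr_ge0 // exprn_ge0.
apply: le_trans _ (ler_wpM2l _ (exp_sum_le _ n qr0)); last first.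
  by rewrite mulr_ge0 // exprn_ge0.
rewrite mulr_sumr; apply: ler_sum => k _.
have re : r ^+ e k <= (1 + r) ^+ j * ((1 + r) ^+ D) ^+ k.
  apply: (@le_trans _ _ ((1 + r) ^+ e k)).
    by rewrite lerXn2r ?nnegrE // lerDr.
  by rewrite -exprM -exprD ler_weXn2l ?lerDl // addnC mulnC.
apply: le_trans (ler_pM _ _ (bA k) re) _ => //; first by rewrite exprn_ge0.
by rewrite exprMn le_eqVlt; apply/orP; left; apply/eqP; ring.
Qed.

(** The weight n <= 2^n is absorbed by doubling q. *)
Lemma exp_dominated_natM b : exp_dominated b ->
  exp_dominated (fun n => n%:R * b n).
Proof.
move=> [A [q [A0 q0 bA]]]; exists A, (2 * q); split => //.
  by rewrite mulr_ge0.
move=> n; rewrite normrM normr_nat exprMn -mulrA mulrCA; apply: ler_pM => //.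
by rewrite -natrX ler_nat ltnW // ltn_expl.
Qed.

Lemma exp_dominatedD b b' : exp_dominated b -> exp_dominated b' ->
  exp_dominated (fun n => b n + b' n).
Proof.
move=> [A [q [A0 q0 bA]]] [A' [q' [A'0 q'0 bA']]].
exists (A + A'), (q + q'); split; rewrite ?addr_ge0 // => n.
rewrite (le_trans (ler_normD _ _)) // mulrDl lerD //.
  apply: le_trans (bA n) _; rewrite ler_wpM2l // ler_wpM2r ?invr_ge0 //.
  by rewrite lerXn2r ?nnegrE ?addr_ge0 // lerDl.
apply: le_trans (bA' n) _; rewrite ler_wpM2l // ler_wpM2r ?invr_ge0 //.
by rewrite lerXn2r ?nnegrE ?addr_ge0 // lerDr.
Qed.

Lemma exp_dominatedZ b x : exp_dominated b ->
  exp_dominated (fun n => x * b n).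
Proof.
move=> [A [q [A0 q0 bA]]]; exists (`|x| * A), q; split => //.
  by rewrite mulr_ge0.
by move=> n; rewrite normrM -mulrA ler_wpM2l.
Qed.

Lemma exp_dominated_abs_geom b x : exp_dominated b -> 0 <= x ->
  exp_dominated (fun n => `|b n| * x ^+ n).
Proof.
move=> [A [q [A0 q0 bA]]] x0; exists A, (q * x); split => //.
  by rewrite mulr_ge0.
move=> n; rewrite normrM normr_id (ger0_norm (exprn_ge0 _ x0)) exprMn.
by rewrite mulrAC mulrA ler_wpM2r ?exprn_ge0 // mulrAC -mulrA.
Qed.

(** The exponents are a parameter so that derivatives and the passage to w = z^D keep one form. The
    real version is for the intermediate, mean and extreme value theorems. *)
Definition rsum b e x : R := limn (series (fun n => b n * x ^+ e n)).
Definition csum b e z : C := limn (series (fun n => (b n)%:C%C * z ^+ e n : C)).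

Lemma cvg_rsum b e D j x : exp_dominated b ->
    (forall n, e n <= n * D + j)%N ->
  series (fun n => b n * x ^+ e n) @ \oo --> rsum b e x.
Proof.
move=> hb he.
have [M HM] := exp_dominated_sum b e D j `|x| hb he (normr_ge0 x).
apply: (@is_cvg_series_abs _ M) => n; apply: le_trans (HM n).
by apply: ler_sum => k _; rewrite normrM normrX.
Qed.

Lemma csum_bound b e D j z : exp_dominated b ->
    (forall n, e n <= n * D + j)%N ->
  exists M, forall n, \sum_(k < n) `|(b k)%:C%C * z ^+ e k| <= M%:C%C.
Proof.
move=> hb he; have nz : `|z| = (complex.Re `|z|)%:C%C.
  by rewrite RRe_real // normr_real.
have r0 : 0 <= complex.Re `|z| by rewrite -ler0c -nz.
have [M HM] := exp_dominated_sum b e D j _ hb he r0.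
exists M => n; move: (HM n); rewrite -lecR rmorph_sum /=; apply: le_trans.
apply: ler_sum => k _.
by rewrite normrM normrX norm_real_complex nz rmorphM rmorphXn.
Qed.

Lemma cvg_csum b e D j z : exp_dominated b ->
    (forall n, e n <= n * D + j)%N ->
  series (fun n => (b n)%:C%C * z ^+ e n : C) @ \oo --> csum b e z.
Proof.
move=> hb he; have [M HM] := csum_bound b e D j z hb he.
exact: (@is_cvg_series_complex _ M).
Qed.

Lemma csum_real b e D j x : exp_dominated b ->
    (forall n, e n <= n * D + j)%N ->
  csum b e x%:C%C = (rsum b e x)%:C%C.
Proof.
move=> hb he; apply: cvg_lim => //.
rewrite (_ : series _ = fun n => (series (fun n => b n * x ^+ e n) n)%:C%C).
  exact: cvg_real_complex (cvg_rsum b e D j x hb he).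
apply/funext => n; rewrite /series /= rmorph_sum /=; apply: eq_bigr => k _.
by rewrite rmorphM rmorphXn.
Qed.

(** The truncated predecessor is harmless: where [e n] is 0, so is the new coefficient. *)
Lemma is_derive_rsum b e D j x : exp_dominated b ->
    (forall n, e n <= n * D + j)%N ->
    exp_dominated (fun n => b n * (e n)%:R) ->
  is_derive x 1 (rsum b e)
    (rsum (fun n => b n * (e n)%:R) (fun n => (e n).-1) x).
Proof.
move=> hb he hb'; apply: (@is_derive_series _ b e _
    (rsum (fun n => b n * (e n)%:R) (fun n => (e n).-1))).
- by move=> y; exact: cvg_rsum hb he.
- by apply: (@cvg_rsum _ _ D j) => // n; exact: leq_trans (leq_pred _) (he n).
- by move=> r; exact: exp_dominated_sum hb he.
Qed.

Lemma is_derive_csum b e D j z : exp_dominated b ->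
    (forall n, e n <= n * D + j)%N ->
    exp_dominated (fun n => b n * (e n)%:R) ->
  is_derive z 1 (csum b e)
    (csum (fun n => b n * (e n)%:R) (fun n => (e n).-1) z).
Proof.
move=> hb he hb'; apply: (@is_derive_series _ (fun n => (b n)%:C%C) e _
    (csum (fun n => b n * (e n)%:R) (fun n => (e n).-1))).
- by move=> y; exact: cvg_csum hb he.
- have h n : ((e n).-1 <= n * D + j)%N by exact: leq_trans (leq_pred _) (he n).
  rewrite [X in series X](_ : _ =
      fun n => (b n * (e n)%:R)%:C%C * z ^+ (e n).-1).
    exact: (cvg_csum _ _ D j).
  by apply/funext => n; rewrite rmorphM /= rmorph_nat.
- move=> r r0; have [M HM] := csum_bound b e D j r hb he; exists M%:C%C => n.
  have := HM n; apply: le_trans; apply: ler_sum => k _.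
  by rewrite normrM normrX (ger0_norm r0).
Qed.

End Series.

(** * Limits of polynomials with positive zeros *)

Section Approximation.
Context {R : realType}.
Local Notation C := (Cplx R).
Implicit Types (b m : nat -> R) (a : nat -> nat -> R) (rho : R) (w : C).

(** Dominated convergence for series. Beyond an index K the tail of [m] is at most eps / 4 and
    counts twice; the first K terms tend to 0 together. *)
Lemma tannery a b m (M : R) :
    (forall k, a N k @[N --> \oo] --> b k) ->
    (forall N k, `|a N k| <= m k) ->
    (forall n, \sum_(k < n) m k <= M) ->
  forall eps : R, 0 < eps ->
  exists N0, forall N n, (N0 <= N)%N -> \sum_(k < n) `|a N k - b k| <= eps.
Proof.
move=> ab am mM eps eps0.
have m0 k : 0 <= m k by apply: le_trans (am 0 k).
have bm k : `|b k| <= m k.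
  by apply: (cvg_norm_le 0 _ _ _ (ab k)) => n _; exact: am.
have cm : cvgn (series m).
  by apply: (is_cvg_series_abs _ M) => n; under eq_bigr do rewrite ger0_norm //.
have e4 : 0 < eps / 4 by rewrite divr_gt0.
have /cvgrPdist_lt/(_ _ e4)[K _ HK] := cm.
have tail n : \sum_(K <= k < K + n) m k <= eps / 4.
  have le1 : series m (K + n)%N <= limn (series m).
    apply: nondecreasing_cvgn_le => //.
    by apply: (@nondecreasing_series R m xpredT 0) => *; exact: m0.
  have := HK K (leqnn K); rewrite ltr_norml => /andP[_ /ltW h].
  rewrite -sub_series_geq ?leq_addr //; apply: le_trans h.
  by rewrite lerD2r.
have head : (fun N => \sum_(k < K) `|a N k - b k|) @ \oo --> (0 : R).
  elim: {HK tail} K => [|K IH].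
    by under eq_fun do rewrite big_ord0; exact: cvg_cst.
  have aK : (fun N => `|a N K - b K|) @ \oo --> (0 : R).
    have := cvg_norm (cvgB (ab K) (cvg_cst (b K))).
    rewrite subrr normr0; exact.
  rewrite (_ : (fun N => _) =
      fun N => \sum_(k < K) `|a N k - b k| + `|a N K - b K|).
    by have := cvgD IH aK; rewrite addr0; exact.
  by apply/funext => N; rewrite big_ord_recr.
have e2 : 0 < eps / 2 by rewrite divr_gt0.
have /cvgrPdist_lt/(_ _ e2)[N0 _ HN0] := head.
exists N0 => N n /HN0 /=; rewrite sub0r normrN => /ltW hN.
have {}hN := le_trans (ler_norm _) hN.
apply: (@le_trans _ _ (\sum_(0 <= k < K + n) `|a N k - b k|)).
  rewrite -(big_mkord xpredT (fun k => `|a N k - b k|)).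
  rewrite [leRHS](big_cat_nat (n := n)) ?leq_addl //= lerDl.
  by rewrite sumr_ge0.
rewrite (big_cat_nat (n := K)) ?leq_addr //= big_mkord.
rewrite (splitr eps) lerD //.
apply: (@le_trans _ _ (2 * \sum_(K <= k < K + n) m k)).
  rewrite mulr_sumr; apply: ler_sum => k _.
  by rewrite (le_trans (ler_normB _ _)) // mulr_natl mulr2n lerD.
by have := tail n; lra.
Qed.

(** Coefficient errors are weighted by rho^k, so one bound serves the whole disc. From [size p] on,
    the partial sums of p are its value. *)
Lemma horner_csum_dist (p : {poly C}) (a0 b : nat -> R) rho w (eps : R) :
    exp_dominated b -> (forall n, p`_n = (a0 n)%:C%C) ->
    0 <= rho -> `|w| <= rho%:C%C ->
    (forall n, \sum_(k < n) `|a0 k * rho ^+ k - b k * rho ^+ k| <= eps) ->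
  `|csum b id w - p.[w]| <= eps%:C%C.
Proof.
move=> hb pa rho0 wr ab.
apply: (@cvg_norm_le _ (size p)
  (fun n => series (fun n => (b n)%:C%C * w ^+ n : C) n - p.[w])).
  apply: cvgB; last exact: cvg_cst.
  by apply: (@cvg_csum _ _ _ 1 0) => // n; rewrite muln1 addn0.
move=> n pn; rewrite (horner_coef_wide _ pn) seriesEord /= -sumrB.
apply: le_trans (ler_norm_sum _ _ _) _.
have := ab n; rewrite -lecR rmorph_sum /=; apply: le_trans.
apply: ler_sum => k _.
rewrite pa -mulrBl -mulrBl normrM normrX -rmorphB norm_real_complex normrM.
rewrite rmorphM /= distrC ler_wpM2l ?ler0c //.
rewrite normrX ger0_norm // rmorphXn lerXn2r ?nnegrE ?normr_ge0 ?ler0c //.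
Qed.

(** Coefficientwise convergence under a common dominating sequence. It implies uniform convergence
    on discs, and still does after weighting by n, that is, for w p'(w). *)
Definition limit_of_recip_prod b := exists (s : nat -> seq R[i])
    (a : nat -> nat -> R) (m : nat -> R),
  [/\ exp_dominated m, forall N n, `|a N n| <= m n,
      forall n, a N n @[N --> \oo] --> b n,
      forall N, {in s N, forall t, 0 < t} &
      forall N n, (recip_prod (s N))`_n = (a N n)%:C%C].

Lemma limit_dominated b a m : exp_dominated m ->
  (forall N n, `|a N n| <= m n) -> (forall n, a N n @[N --> \oo] --> b n) ->
  exp_dominated b.
Proof.
move=> [A [q [A0 q0 mA]]] am ab; exists A, q; split => // n.
apply: (cvg_norm_le 0 _ _ _ (ab n)) => N _.
exact: le_trans (am N n) (le_trans (ler_norm _) (mA n)).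
Qed.

Lemma horner_cvg_csum (p : nat -> {poly C}) b a m rho (eps : R) :
    exp_dominated m -> (forall N n, `|a N n| <= m n) ->
    (forall n, a N n @[N --> \oo] --> b n) ->
    (forall N n, (p N)`_n = (a N n)%:C%C) -> 0 <= rho -> 0 < eps ->
  exists N0, forall N w, (N0 <= N)%N -> `|w| <= rho%:C%C ->
    `|csum b id w - (p N).[w]| <= eps%:C%C.
Proof.
move=> hm am ab pa rho0 eps0.
have hid n : (n <= n * 1 + 0)%N by rewrite muln1 addn0.
have [M HM] := exp_dominated_sum m id 1 0 rho hm hid rho0.
have [|||N0 HN0] := tannery (fun N n => a N n * rho ^+ n)
  (fun n => b n * rho ^+ n)
  (fun n => m n * rho ^+ n) M _ _ _ eps eps0.
- by move=> k; apply: cvgMr_tmp; exact: ab.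
- by move=> N k; rewrite normrM normrX (ger0_norm rho0) ler_wpM2r ?exprn_ge0.
- move=> n; apply: le_trans (HM n); apply: ler_sum => k _.
  by rewrite ler_wpM2r ?exprn_ge0 // ler_norm.
exists N0 => N w N0N wr.
apply: (horner_csum_dist _ (a N) b rho) => //.
  exact: (limit_dominated _ a m).
by move=> n; exact: HN0.
Qed.

(** The bounds of [recip_prod_disc] in the limit. The third one is the limit of sum t^2 <= (sum t) /
    rho, true since every t rho < 1. *)
Lemma csum_disc b rho w : limit_of_recip_prod b -> 0 < rho ->
    (forall x, 0 <= x <= rho -> 0 < rsum b id x) -> `|w| <= rho%:C%C ->
  [/\ (rsum b id rho)%:C%C <= `|csum b id w|,
      `|csum (fun n => n%:R * b n) id w| * (rsum b id rho)%:C%C <=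
        - (rsum (fun n => n%:R * b n) id rho)%:C%C * `|csum b id w| &
      b 1 ^+ 2 - 2 * b 2 <= - b 1 / rho].
Proof.
move=> [s [a [m [hm am ab s0 sa]]]] rho0 bpos wr.
have hb := limit_dominated _ _ _ hm am ab.
have hid n : (n <= n * 1 + 0)%N by rewrite muln1 addn0.
(* The minimum over [0, rho] is positive, and polynomials within half of it have no zero there. *)
have [x0 x0rho minb] : exists2 c, c \in `[0, rho]%R &
    forall t, t \in `[0, rho]%R -> rsum b id c <= rsum b id t.
  apply: EVT_min; first exact: ltW.
  apply: derivable_within_continuous => x _.
  have hb' : exp_dominated (fun n => b n * n%:R).
    by under eq_fun do rewrite mulrC; exact: exp_dominated_natM.
  have h := is_derive_rsum b id 1 0 x hb hid hb'.
  exact: ex_derive.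
have mu0 : 0 < rsum b id x0 by apply: bpos; move: x0rho; rewrite in_itv.
have [N0 HN0] := horner_cvg_csum (fun N => recip_prod (s N)) b a m rho
  (rsum b id x0 / 2) hm am ab sa (ltW rho0) (divr_gt0 mu0 (ltr0n _ 2)).
have srho N : (N0 <= N)%N -> {in s N, forall t, 0 < t /\ t * rho%:C%C < 1}.
  move=> N0N t ts; have t0 := s0 N t ts; split => //.
  have [tau tau0 tE] := gt0_real_complex t t0.
  (* Otherwise the zero 1 / tau of the polynomial would lie in [0, rho]. *)
  rewrite tE -rmorphM -(rmorph1 (real_complex R)) ltcR ltNge; apply/negP => tr.
  have taur : 0 <= tau^-1 <= rho.
    by rewrite invr_ge0 ltW //= -(ler_pM2l tau0) divff ?gt_eqF.
  have tauC : `|(tau^-1)%:C%C : C| <= rho%:C%C.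
    by rewrite norm_real_complex lecR ger0_norm; case/andP: taur.
  have := HN0 N _ N0N tauC; rewrite (csum_real b id 1 0) //.
  have -> : (recip_prod (s N)).[(tau^-1)%:C%C] = 0.
    apply/eqP; rewrite /recip_prod horner_prod prodf_seq_eq0.
    apply/hasP; exists t => //=.
    by rewrite !hornerE tE -rmorphM divff ?lt0r_neq0 // rmorph1 subrr.
  rewrite subr0 norm_real_complex lecR => h.
  have := minb tau^-1; rewrite in_itv /= => /(_ taur) h2.
  have := le_trans (ler_norm _) h; lra.
have cvp v : `|v| <= rho%:C%C ->
    (fun N => (recip_prod (s N)).[v] : C) @ \oo --> (csum b id v : C).
  move=> vr; apply/cvgrPdist_le => _ /gt0_real_complex[eps eps0 ->].
  have [N1 HN1] := horner_cvg_csum (fun N => recip_prod (s N)) b a m rho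
    eps hm am ab sa (ltW rho0) eps0.
  by exists N1 => // N /= /HN1; apply.
have cvdp v : `|v| <= rho%:C%C ->
    (fun N => v * (recip_prod (s N))^`().[v] : C) @ \oo -->
    (csum (fun n => n%:R * b n) id v : C).
  move=> vr; apply/cvgrPdist_le => _ /gt0_real_complex[eps eps0 ->].
  have am' N n : `|n%:R * a N n| <= n%:R * m n.
    by rewrite normrM normr_nat ler_wpM2l.
  have ab' n : n%:R * a N n @[N --> \oo] --> n%:R * b n.
    by apply: cvgMl_tmp; exact: ab.
  have sa' N n : ('X * (recip_prod (s N))^`())`_n = (n%:R * a N n)%:C%C.
    rewrite coefXM; case: n => [|n] /=; first by rewrite mul0r.
    by rewrite coef_deriv sa -[_ *+ _]mulr_natl rmorphM rmorph_nat.
  have [N1 HN1] := horner_cvg_csum (fun N => 'X * (recip_prod (s N))^`())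
    _ _ _ rho eps (exp_dominated_natM _ hm) am' ab' sa' (ltW rho0) eps0.
  by exists N1 => // N /= N1N; have := HN1 N v N1N vr; rewrite hornerM hornerX.
have rr : `|rho%:C%C : C| <= rho%:C%C.
  by rewrite norm_real_complex gtr0_norm // lexx.
have rho0C : 0 <= rho%:C%C :> R[i] by rewrite ler0c ltW.
have disc N : (N0 <= N)%N -> _ := fun N0N =>
  recip_prod_disc (s N) rho%:C%C w (srho N N0N) rho0C wr.
have P1 := cvp _ rr; have P2 := cvp _ wr.
have D1 := cvdp _ rr; have D2 := cvdp _ wr.
rewrite -(csum_real b id 1 0 rho hb hid).
rewrite -(csum_real _ id 1 0 rho (exp_dominated_natM _ hb) hid).
split.
- rewrite -subr_ge0.
  apply: (cvg_ge0 N0 _ _ (cvgB (cvg_norm P2) P1)) => N N0N /=.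
  by have [_ h _ _] := disc N N0N; rewrite subr_ge0.
- rewrite -subr_ge0; apply: (cvg_ge0 N0 _ _
    (cvgB (cvgM (cvgN D1) (cvg_norm P2)) (cvgM (cvg_norm D2) P1))) => N N0N /=.
  by have [_ _ _ h] := disc N N0N; rewrite subr_ge0.
rewrite -subr_ge0.
apply: (cvg_ge0 N0 (fun N => - a N 1 / rho - (a N 1 ^+ 2 - 2 * a N 2))).
  apply: cvgB; first by apply: cvgMr_tmp; apply: cvgN; exact: ab.
  apply: cvgB; last by apply: cvgMl_tmp; exact: ab.
  by rewrite expr2; under eq_fun do rewrite expr2; apply: cvgM; exact: ab.
move=> N N0N; rewrite subr_ge0 -lecR.
have [_ [E1 E2]] := recip_prod_coefs (s N).
have -> : (a N 1 ^+ 2 - 2 * a N 2)%:C%C = \sum_(t <- s N) t ^+ 2.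
  by rewrite -E2 !sa rmorphB rmorphXn rmorphM rmorph_nat.
rewrite rmorphM rmorphN /= -sa E1 opprK fmorphV.
rewrite ler_pdivlMr ?ltcR // mulr_suml.
rewrite big_seq [leRHS]big_seq; apply: ler_sum => t ts.
have [t0 tr] := srho N N0N t ts.
by rewrite expr2 -mulrA -[leRHS]mulr1 ler_wpM2l // ltW.
Qed.

End Approximation.

(** * Operations on sums, and their zeros on the positive axis *)

Section SumCalculus.
Context {R : realType}.
Local Notation C := (Cplx R).
Implicit Types (b : nat -> R) (e : nat -> nat) (z : C) (x : R).

Lemma csumD b b' e D j z : exp_dominated b -> exp_dominated b' ->
    (forall n, e n <= n * D + j)%N ->
  csum (fun n => b n + b' n) e z = csum b e z + csum b' e z.
Proof.
move=> hb hb' he; apply: cvg_lim => //.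
rewrite (_ : series _ = fun n => series (fun n => (b n)%:C%C * z ^+ e n : C) n +
    series (fun n => (b' n)%:C%C * z ^+ e n : C) n).
  by apply: cvgD; apply: (cvg_csum _ _ D j).
apply/funext => n; rewrite /series /= -big_split /=.
by apply: eq_bigr => k _; rewrite rmorphD mulrDl.
Qed.

Lemma csumZ b e D j x z : exp_dominated b -> (forall n, e n <= n * D + j)%N ->
  csum (fun n => x * b n) e z = x%:C%C * csum b e z.
Proof.
move=> hb he; apply: cvg_lim => //.
rewrite (_ : series _ = fun n => x%:C%C *
    series (fun n => (b n)%:C%C * z ^+ e n : C) n).
  by apply: cvgMl_tmp; apply: (cvg_csum _ _ D j).
apply/funext => n; rewrite /series /= mulr_sumr.
by apply: eq_bigr => k _; rewrite rmorphM mulrA.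
Qed.

(** Where [e n] is 0, the predecessor is 0 as well and the factor z would raise the power to 1; the
    coefficient must vanish there. *)
Lemma mul_csum b e D j z : exp_dominated b -> (forall n, e n <= n * D + j)%N ->
    (forall n, e n = 0%N -> b n = 0) ->
  z * csum b (fun n => (e n).-1) z = csum b e z.
Proof.
move=> hb he b0; apply/esym; apply: cvg_lim => //.
rewrite (_ : series _ = fun n => z *
    series (fun n => (b n)%:C%C * z ^+ (e n).-1 : C) n).
  apply: cvgMl_tmp; apply: (cvg_csum _ _ D j) => // n.
  exact: leq_trans (leq_pred _) (he n).
apply/funext => n; rewrite /series /= mulr_sumr.
apply: eq_bigr => k _; case: (e k) (b0 k) => [->//|m _].
  by rewrite !mul0r mulr0.
by rewrite exprS mulrCA.
Qed.

Lemma csum_comp b D z : csum b (fun n => n * D)%N z = csum b id (z ^+ D).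
Proof.
rewrite /csum; congr (limn (series _)); apply/funext => n.
by rewrite mulnC exprM.
Qed.

Lemma rsum_comp b D x : rsum b (fun n => n * D)%N x = rsum b id (x ^+ D).
Proof.
rewrite /rsum; congr (limn (series _)); apply/funext => n.
by rewrite mulnC exprM.
Qed.

Lemma derive1_csum b e D j : exp_dominated b ->
    (forall n, e n <= n * D + j)%N ->
    exp_dominated (fun n => b n * (e n)%:R) ->
  derive1 (csum b e) = csum (fun n => b n * (e n)%:R) (fun n => (e n).-1).
Proof.
move=> hb he hb'; apply/funext => z; rewrite derive1E.
by have h := is_derive_csum b e D j z hb he hb'; rewrite derive_val.
Qed.

Lemma rsum0 b : exp_dominated b -> rsum b id 0 = b 0.
Proof.
move=> hb; apply: cvg_lim => //.
apply/cvgrPdist_lt => eps eps0; exists 1%N => // -[//|n] _.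
rewrite seriesEord /= big_ord_recl big1 => [|k _].
  by rewrite expr0 mulr1 addr0 subrr normr0.
by rewrite exprS mul0r mulr0.
Qed.

Lemma exp_dominated_affine b x D j : exp_dominated b ->
  exp_dominated (fun n => b n * (x * (n * D + j)%:R)).
Proof.
move=> hb; rewrite (_ : (fun n => _) = fun n =>
    (x * D%:R) * (n%:R * b n) + (x * j%:R) * b n).
  apply: exp_dominatedD; apply: exp_dominatedZ => //.
  exact: exp_dominated_natM.
by apply/funext => n; rewrite natrD natrM; ring.
Qed.

Lemma continuous_rsum b : exp_dominated b -> continuous (rsum b id : R -> R).
Proof.
move=> hb x; apply: differentiable_continuous; apply/derivable1_diffP.
have hb' : exp_dominated (fun n => b n * n%:R).
  by under eq_fun do rewrite mulrC; exact: exp_dominated_natM.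
have hid n : (n <= n * 1 + 0)%N by rewrite muln1 addn0.
have h := is_derive_rsum b id 1 0 x hb hid hb'.
exact: ex_derive.
Qed.

Lemma ex_root x m : 0 < x -> (0 < m)%N -> exists2 y : R, 0 < y & y ^+ m = x.
Proof.
move=> x0 m0; exists (x `^ (m%:R^-1)); first exact: powR_gt0.
rewrite -powR_mulrn ?powR_ge0 // -powRrM mulVf ?powRr1 ?ltW //.
by rewrite pnatr_eq0 -lt0n.
Qed.

(* [x * F (x ^+ m)], where [F] is the sum of [b], has derivative
   [G (x ^+ m)], where [G] is the sum of [(1 + m n) b_n]. *)
Lemma rsum_gt0_of_deriv b m X : (0 < m)%N -> exp_dominated b -> 0 < b 0 ->
    (forall x, 0 <= x <= X -> 0 < rsum (fun n => b n * (n * m + 1)%:R) id x) ->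
  forall x, 0 <= x <= X -> 0 < rsum b id x.
Proof.
move=> m0 hb b0 hG y /andP[]; rewrite le_eqVlt => /orP[/eqP <- _|y0 yX].
  by rewrite rsum0.
have [x x0 xy] := ex_root y m y0 m0.
pose psi := rsum b (fun n => n * m + 1)%N.
have hb' : exp_dominated (fun n => b n * (n * m + 1)%:R).
  have := exp_dominated_affine b 1 m 1 hb.
  by under eq_fun do rewrite mul1r.
have psiE t : psi t = t * rsum b id (t ^+ m).
  apply: cvg_lim => //.
  rewrite (_ : series _ = fun n => t *
      series (fun n => b n * (t ^+ m) ^+ n) n).
    apply: cvgMl_tmp; apply: (cvg_rsum _ id 1 0) => // n.
    by rewrite muln1 addn0.
  apply/funext => n; rewrite /series /= mulr_sumr; apply: eq_bigr => k _.
  by rewrite addn1 exprS mulnC exprM mulrCA.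
have dpsi (t : R) : is_derive t 1 psi
    (rsum (fun n => b n * (n * m + 1)%:R) id (t ^+ m)).
  have := is_derive_rsum b (fun n => n * m + 1)%N m 1 t hb
    (fun n => leqnn _) hb'.
  rewrite -rsum_comp (_ : (fun n => (n * m + 1).-1) = (fun n => n * m)%N) //.
  by apply/funext => n; rewrite addn1.
(* The mean value theorem on [0, x] gives F(y) = G(c^m), where y = x^m. *)
have [|c c0x] := MVT x0 (fun t _ => dpsi t).
  by apply: derivable_within_continuous => t _; exact: ex_derive.
move: c0x; rewrite in_itv /= => /andP[c0 cx].
rewrite !psiE mul0r !subr0 xy mulrC => /(mulIf (lt0r_neq0 x0)) ->.
have {}c0 := ltW c0; apply: hG; rewrite exprn_ge0 //= (le_trans _ yX) // -xy.
by rewrite lerXn2r ?nnegrE // ltW.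
Qed.

(** The infimum of the positive zeros is a zero by continuity, and it is not 0 because the sum is
    positive there. By the intermediate value theorem, a nonpositive value before it would yield a
    smaller zero. *)
Lemma rsum_least_zero b : exp_dominated b -> 0 < b 0 ->
    ~ (forall x, 0 <= x -> 0 < rsum b id x) ->
  exists r, [/\ 0 < r, rsum b id r = 0 &
    forall x, 0 <= x < r -> 0 < rsum b id x].
Proof.
move=> hb b0 nonpos; pose G := rsum b id.
have G0 : 0 < G 0 by rewrite /G rsum0.
have Gc : continuous (G : R -> R) by exact: continuous_rsum.
have ivt x : 0 <= x -> G x <= 0 -> exists2 t, 0 < t <= x & G t = 0.
  move=> x0 Gx; have [||c] := @IVT R G 0 x 0 x0.
  - exact: continuous_subspaceT.
  - by rewrite ge_min le_max Gx orbT ltW.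
  rewrite in_itv /= => /andP[c0 cx] Gc0; exists c => //.
  rewrite cx andbT lt_neqAle c0 andbT; apply/eqP => c0E.
  by move: G0; have := Gc0; rewrite -c0E => ->; rewrite ltxx.
pose S := [set x | 0 < x /\ G x = 0].
have S0 : S !=set0.
  move/existsNP : nonpos => [x /not_implyP[x0 /negP]]; rewrite -leNgt => Gx.
  by have [t /andP[t0 _] Gt] := ivt x x0 Gx; exists t.
have lbS : lbound S 0 by move=> t [/ltW].
have hinf : has_inf S by split => //; exists 0.
have r0 : 0 <= inf S by apply: lb_le_inf.
have Gr : G (inf S) = 0.
  apply/eqP; apply/negPn/negP => Gr.
  have e0 : 0 < `|G (inf S)| by rewrite normr_gt0.
  have /cvgrPdist_lt/(_ _ e0)/nbhs_ballP[dl /= dl0 hdl] := Gc (inf S).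
  have [t [t0 Gt] tl] := inf_adherent dl0 hinf.
  have : ball (inf S) dl t.
    rewrite /ball /= distrC ger0_norm ?ltrBlDl // subr_ge0.
    by apply: ge_inf; [exists 0|split].
  by move=> /hdl; rewrite /= Gt subr0 ltxx.
exists (inf S); split => //.
  rewrite lt_neqAle r0 andbT; apply/eqP => r0E.
  by move: G0; have := Gr; rewrite -r0E => ->; rewrite ltxx.
move=> x /andP[x0 xr]; rewrite ltNge; apply/negP => Gx.
have [t /andP[t0 tx] Gt] := ivt x x0 Gx.
have : inf S <= t by apply: ge_inf; [exists 0|split].
by rewrite leNgt (le_lt_trans tx xr).
Qed.

End SumCalculus.

(** * Pochhammer symbols and their ratios *)

Section Pochhammer.
Context {R : realType}.
Implicit Types (a x : R).

Lemma pochhammer_gt0 a n : 0 < a -> 0 < pochhammer a n.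
Proof. by move=> a0; apply: prodr_gt0 => k _; rewrite ltr_wpDr. Qed.

Lemma pochhammerD a m n :
  pochhammer a (m + n) = pochhammer a m * pochhammer (a + m%:R) n.
Proof.
rewrite /pochhammer big_split_ord /=; congr (_ * _).
by apply: eq_bigr => k _; rewrite natrD addrA.
Qed.

(** Split (a)_(P + n) in two ways. Up to the numerator, 1 / (a)_n becomes a product of multipliers 1
    + n b with b > 0. *)
Lemma prod_pochhammer a P n : 0 < a ->
  \prod_(k < P) (1 + n%:R / (a + k%:R)) =
  pochhammer (a + P%:R) n / pochhammer a n.
Proof.
move=> a0; have p0 m : pochhammer a m != 0 by rewrite gt_eqF // pochhammer_gt0.
apply: (mulIf (p0 n)); rewrite divfK //; apply: (mulIf (p0 P)).
rewrite [RHS]mulrC -pochhammerD addnC pochhammerD mulrAC [RHS]mulrC.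
congr (_ * _); rewrite /pochhammer -big_split /=; apply: eq_bigr => k _.
by field; rewrite gt_eqF // ltr_wpDr.
Qed.

Lemma pochhammer_ge a n : 0 < a -> Num.min a 1 ^+ n <= pochhammer a n.
Proof.
move=> a0; rewrite -[n in _ ^+ n]card_ord -prodr_const.
apply: ler_prod => k _; apply/andP; split; first by rewrite le_min ltW /=.
by rewrite ge_min lerDl ler0n.
Qed.

Lemma natr_ffact P n :
  (P ^_ n)%:R = \prod_(k < n) (P%:R - k%:R) :> R.
Proof.
elim: n => [|n IH]; first by rewrite ffactn0 big_ord0.
rewrite big_ord_recr /= -IH ffactnSr natrM.
(* For n > P truncated subtraction differs from the real one, but the falling factorial is already
   0. *)
by have [nP|Pn] := leqP n P; [rewrite natrB | rewrite ffact_small // !mul0r].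
Qed.

(** For fixed n each factor tends to 1 as P grows; [pochhammer_ratio] has the same purpose. *)
Lemma ffact_ratio P n : (0 < P)%N ->
  (P ^_ n)%:R / P%:R ^+ n = \prod_(k < n) (1 - k%:R / P%:R) :> R.
Proof.
move=> P0; have P1 : P%:R != 0 :> R by rewrite pnatr_eq0 -lt0n.
apply: (mulIf (expf_neq0 n P1)); rewrite divfK ?expf_neq0 // natr_ffact.
rewrite -[n in _ ^+ n]card_ord -prodr_const -big_split /=.
by apply: eq_bigr => k _; field.
Qed.

Lemma pochhammer_ratio a P n : (0 < P)%N ->
  pochhammer (a + P%:R) n / P%:R ^+ n = \prod_(k < n) (1 + (a + k%:R) / P%:R).
Proof.
move=> P0; have P1 : P%:R != 0 :> R by rewrite pnatr_eq0 -lt0n.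
apply: (mulIf (expf_neq0 n P1)); rewrite divfK ?expf_neq0 //.
rewrite -[n in _ ^+ n]card_ord -prodr_const -big_split /=.
by apply: eq_bigr => k _; field.
Qed.

Lemma cvg_prod1 (I : Type) (r : seq I) (u : I -> nat -> R) :
  (forall i, u i @ \oo --> (1 : R)) ->
  (fun N => \prod_(i <- r) u i N) @ \oo --> (1 : R).
Proof.
move=> u1; elim: r => [|i r IH].
  by under eq_fun do rewrite big_nil; exact: cvg_cst.
rewrite (_ : (fun N => _) = fun N => u i N * \prod_(j <- r) u j N).
  by have := cvgM (u1 i) IH; rewrite mulr1; exact.
by apply/funext => N; rewrite big_cons.
Qed.

Lemma cvg_1Ddiv x : (fun N => 1 + x / N.+1%:R) @ \oo --> (1 : R).
Proof.
have := cvgD (cvg_cst (1 : R)) (cvgMl_tmp (a := x) (@cvg_harmonic R)).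
by rewrite mulr0 addr0; exact.
Qed.

Lemma ffact_ratio_le1 P n : (0 < P)%N ->
  0 <= ((P ^_ n)%:R / P%:R ^+ n : R) <= 1.
Proof.
move=> P0; rewrite divr_ge0 ?exprn_ge0 //= ler_pdivrMr ?exprn_gt0 ?ltr0n //.
rewrite mul1r -natrX ler_nat.
elim: n => [|n IH]; first by rewrite ffactn0.
by rewrite ffactnSr expnSr leq_mul // leq_subr.
Qed.

(** For k < n <= P each factor 1 + (a + k) / P is at most 2 + a. *)
Lemma pochhammer_ratio_le a P n : 0 < a -> (0 < P)%N -> (n <= P)%N ->
  0 <= pochhammer (a + P%:R) n / P%:R ^+ n <= (2 + a) ^+ n.
Proof.
move=> a0 P0 nP; have P0' : 0 < P%:R :> R by rewrite ltr0n.
rewrite divr_ge0 ?exprn_ge0 //=; last first.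
  by apply/ltW/pochhammer_gt0; rewrite addr_gt0.
rewrite pochhammer_ratio // -[n in _ ^+ n]card_ord -prodr_const.
apply: ler_prod => k _; apply/andP; split.
  by rewrite addr_ge0 // divr_ge0 ?ltW // ltr_wpDr.
rewrite mulrDl addrA addrAC lerD //.
  rewrite (_ : 2 = 1 + 1) // lerD2l ler_pdivrMr // mul1r ler_nat.
  by rewrite ltnW // (leq_trans (ltn_ord k)).
by rewrite ler_pdivrMr // ler_peMr ?ler1n // ltW.
Qed.

End Pochhammer.

(** * Hyper-Bessel coefficients and their polynomial approximations *)

Section HyperBessel.
Context {R : realType} {d : nat}.
Context (alpha : 'I_d -> R) (halpha : forall i, -1 < alpha i).

Let a0 i : 0 < alpha i + 1. Proof. by rewrite -ltrBlDr sub0r. Qed.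

(** The scaling of z by 1 / D is absorbed, so that the sum runs over the powers of w = z^D. *)
Definition bessel_coef (n : nat) : R :=
  hyper_bessel_coef alpha n / d.+1%:R ^+ (n * d.+1).

(** The factor 1 / n! is kept; the Pochhammer symbols contribute a geometric factor, and the power
    of D is at least 1. *)
Lemma bessel_coef_dominated : exp_dominated bessel_coef.
Proof.
pose mu i := Num.min (alpha i + 1) 1.
have mu0 i : 0 < mu i by rewrite lt_min a0 /=.
have [q0 q1] : 0 < \prod_i mu i /\ 0 <= (\prod_i mu i)^-1.
  by split; [|rewrite invr_ge0 ltW]; rewrite ?prodr_gt0.
exists 1, ((\prod_i mu i)^-1); split => // n.
rewrite mul1r /bessel_coef /hyper_bessel_coef.
have h1 : 0 < \prod_(i < d) pochhammer (alpha i + 1) n.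
  by apply: prodr_gt0 => i _; exact: pochhammer_gt0.
have h2 : (\prod_i mu i) ^+ n <= \prod_(i < d) pochhammer (alpha i + 1) n.
  rewrite -prodrXl; apply: ler_prod => i _.
  by apply/andP; split; [rewrite exprn_ge0 // ltW | exact: pochhammer_ge].
rewrite !normrM normrX normrN1 expr1n mul1r !normfV normrX !normr_nat.
rewrite normrM normr_nat (gtr0_norm h1) invfM exprVn [leRHS]mulrC -mulrA.
rewrite ler_wpM2l ?invr_ge0 //.
apply: (@le_trans _ _ ((\prod_(i < d) pochhammer (alpha i + 1) n)^-1)).
  rewrite ler_piMr ?invr_ge0 ?(ltW h1) // invf_le1 ?exprn_gt0 ?ltr0n //.
  by rewrite exprn_ege1 // ler1n.
by rewrite lef_pV2 // posrE ?exprn_gt0.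
Qed.

(** The coefficients g_n of g, from differentiating z^(1 + n D). *)
Definition bessel_deriv_coef (n : nat) : R :=
  (1 + n%:R * d.+1%:R) * bessel_coef n.

Lemma bessel_deriv_coef_dominated : exp_dominated bessel_deriv_coef.
Proof.
rewrite (_ : bessel_deriv_coef =
    fun n => bessel_coef n + d.+1%:R * (n%:R * bessel_coef n)).
  apply: exp_dominatedD; first exact: bessel_coef_dominated.
  apply: exp_dominatedZ; apply: exp_dominated_natM.
  exact: bessel_coef_dominated.
by apply/funext => n; rewrite /bessel_deriv_coef; ring.
Qed.

(** The limit times corrections tending to 1: convergence and domination show in this form,
    membership among the [recip_prod] in that of [approx_coefE]. *)
Definition approx_coef (N n : nat) : R :=
  bessel_deriv_coef n * ((N.+1 ^_ n)%:R / N.+1%:R ^+ n *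
    \prod_(i < d) (pochhammer (alpha i + 1 + N.+1%:R) n / N.+1%:R ^+ n)).

(** The scale ((N + 1) D)^(-D) collects one power of 1 / (N + 1) from the binomial coefficient, d
    powers from the Pochhammer numerators, and the normalization D^(-D). *)
Lemma approx_coefE N n : approx_coef N n =
  (-1) ^+ n * 'C(N.+1, n)%:R * ((N.+1%:R * d.+1%:R) ^- d.+1) ^+ n *
  ((1 + n%:R * d.+1%:R) *
   \prod_(i < d) \prod_(k < N.+1) (1 + n%:R / (alpha i + 1 + k%:R))).
Proof.
under eq_bigr do rewrite prod_pochhammer //.
have p0 : 0 < \prod_(i < d) pochhammer (alpha i + 1) n.
  by apply: prodr_gt0 => i _; exact: pochhammer_gt0.
have E : ((N.+1%:R * d.+1%:R) ^- d.+1) ^+ n =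
    (d.+1%:R ^+ (n * d.+1) * (N.+1%:R ^+ n * (N.+1%:R ^+ n) ^+ d))^-1 :> R.
  by rewrite exprVn -exprM -exprS -exprM exprMn mulrC [(d.+1 * n)%N]mulnC.
rewrite E /approx_coef /bessel_deriv_coef /bessel_coef /hyper_bessel_coef.
rewrite -bin_ffact natrM !big_split /= !prodfV prodr_const card_ord.
move: p0; set p := \prod_(_ < _) pochhammer (alpha _ + 1) _.
set q := \prod_(_ < _) pochhammer _ _ => p0.
have N0 : N.+1%:R ^+ n != 0 :> R by rewrite expf_neq0 // pnatr_eq0.
have D0 : d.+1%:R ^+ (n * d.+1) != 0 :> R by rewrite expf_neq0 // pnatr_eq0.
have Nd0 : (N.+1%:R ^+ n) ^+ d != 0 :> R by rewrite expf_neq0.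
move: N0 D0 Nd0; move: ((N.+1%:R ^+ n) ^+ d : R) => u.
move: (d.+1%:R ^+ (n * d.+1) : R) (N.+1%:R ^+ n : R) => v w w0 v0 u0.
move: ((-1) ^+ n : R) (d.+1%:R : R) => t D.
by field; rewrite w0 v0 u0 pnatr_eq0 -lt0n fact_gt0 gt_eqF.
Qed.

Lemma cvg_approx_coef n : approx_coef N n @[N --> \oo] --> bessel_deriv_coef n.
Proof.
rewrite -[X in _ --> X]mulr1; apply: cvgMl_tmp.
rewrite -[X in _ --> X]mulr1; apply: cvgM.
  under eq_fun do rewrite ffact_ratio //.
  by apply: cvg_prod1 => k; under eq_fun do rewrite -mulNr; exact: cvg_1Ddiv.
apply: cvg_prod1 => i.
under eq_fun do rewrite pochhammer_ratio //.
by apply: cvg_prod1 => k; exact: cvg_1Ddiv.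
Qed.

Lemma approx_coef_le N n : `|approx_coef N n| <=
  `|bessel_deriv_coef n| * (\prod_(i < d) (2 + (alpha i + 1))) ^+ n.
Proof.
rewrite normrM ler_wpM2l //.
have h0 : 0 <= (\prod_(i < d) (2 + (alpha i + 1))) ^+ n.
  by rewrite exprn_ge0 // prodr_ge0 // => i _; rewrite addr_ge0 // ltW.
(* For n > N + 1 the falling factorial vanishes; otherwise [pochhammer_ratio_le] applies. *)
have [nN|Nn] := leqP n N.+1; last by rewrite ffact_small // !mul0r normr0.
have [r0 r1] := andP (ffact_ratio_le1 (R := R) N.+1 n isT).
set q := \prod_(i < d) _.
have poch i := pochhammer_ratio_le _ N.+1 n (a0 i) isT nN.
have q0 : 0 <= q by apply: prodr_ge0 => i _; case/andP: (poch i).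
have q1 : q <= (\prod_(i < d) (2 + (alpha i + 1))) ^+ n.
  by rewrite -prodrXl; apply: ler_prod => i _; exact: poch.
rewrite ger0_norm; last exact: mulr_ge0.
by rewrite -[leRHS]mul1r ler_pM.
Qed.

Lemma bessel_deriv_limit : limit_of_recip_prod bessel_deriv_coef.
Proof.
have /choice[s sP] : forall N, exists s : seq R[i], {in s, forall t, 0 < t} /\
    forall n, (recip_prod s)`_n = (approx_coef N n)%:C%C.
  move=> N; pose f (p : 'I_d * 'I_N.+1) : R := (alpha p.1 + 1 + p.2%:R)^-1.
  (* The multiplier D turns the coefficients of J into those of f'; the others produce the
     Pochhammer symbols. *)
  pose L : seq R[i] :=
    d.+1%:R :: [seq (f p)%:C%C | p <- enum {: 'I_d * 'I_N.+1}].
  have [||s s0 sE] := recip_prod_multiplier N.+1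
      ((N.+1%:R * d.+1%:R) ^- d.+1)%:C%C L.
  - by rewrite ltcR invr_gt0 exprn_gt0 // mulr_gt0 ?ltr0n.
  - move=> b; rewrite in_cons => /orP[/eqP ->|/mapP[p _ ->]].
      by rewrite ltr0n.
    by rewrite ltcR invr_gt0 ltr_wpDr.
  exists s; split => // n.
  rewrite sE approx_coefE /L big_cons big_map big_enum /= pair_bigA /=.
  rewrite !rmorphM !rmorph_prod /= !rmorphXn rmorphN1 rmorphD rmorph1.
  rewrite rmorphM !rmorph_nat; congr (_ * (_ * _)).
  by apply: eq_bigr => p _; rewrite rmorphD rmorph1 rmorphM /= rmorph_nat.
exists s, approx_coef, (fun n => `|bessel_deriv_coef n| *
  (\prod_(i < d) (2 + (alpha i + 1))) ^+ n); split.
- apply: exp_dominated_abs_geom; first exact: bessel_deriv_coef_dominated.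
  by rewrite prodr_ge0 // => i _; rewrite addr_ge0 // ltW.
- exact: approx_coef_le.
- exact: cvg_approx_coef.
- by move=> N; have [] := sP N.
- by move=> N; have [] := sP N.
Qed.

(** * Derivatives and the equation of the theorem as power series *)

(** The coefficients of G = g + 2 D w g', with the weight in the form n m + 1 that
    [rsum_gt0_of_deriv] uses, m = 2 D. *)
Definition convexity_coef (n : nat) : R :=
  bessel_deriv_coef n * (n * (2 * d.+1) + 1)%:R.

Definition bessel_expo (n : nat) : nat := (n * d.+1)%N.

Local Notation C := (Cplx R).
Local Notation D := d.+1.
Local Notation c := bessel_coef.
Local Notation g := bessel_deriv_coef.
Local Notation G := convexity_coef.
Local Notation e := bessel_expo.
Local Notation f := (fun z : C => z * hyper_bessel alpha z).
Implicit Types (z : C) (x r : R).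

Let hc : exp_dominated c. Proof. exact: bessel_coef_dominated. Qed.

Let hg : exp_dominated g. Proof. exact: bessel_deriv_coef_dominated. Qed.

Let hge : exp_dominated (fun n => g n * (e n)%:R).
Proof.
have := exp_dominated_affine g 1 D 0 hg.
by under eq_fun do rewrite mul1r addn0.
Qed.

Lemma convexity_coef_dominated : exp_dominated G.
Proof.
have := exp_dominated_affine g 1 (2 * D) 1 hg.
by under eq_fun do rewrite mul1r.
Qed.

Let hce : exp_dominated (fun n => c n * (e n)%:R).
Proof.
have := exp_dominated_affine c 1 D 0 hc.
by under eq_fun do rewrite mul1r addn0.
Qed.

Let hcee : exp_dominated (fun n => c n * (e n)%:R * (e n).-1%:R).
Proof.
rewrite (_ : (fun n => _) = fun n =>
    c n * (e n)%:R * (1 * (n * D + 0)%:R) + (-1) * (c n * (e n)%:R)).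
  apply: exp_dominatedD; last exact: exp_dominatedZ.
  exact: (exp_dominated_affine _ 1 D 0 hce).
apply/funext => n; rewrite addn0 -/(e n); case: (e n) => [|m].
  by rewrite !mulr0 addr0.
by rewrite /= -[m.+1%:R in X in _ = X + _]natr1; ring.
Qed.

Lemma hyper_besselE : hyper_bessel alpha = csum c e.
Proof.
apply/funext => z; rewrite /hyper_bessel /csum.
congr (limn (series _)); apply/funext => n.
rewrite expr_div_n /c /bessel_coef; move: (hyper_bessel_coef alpha n) => h.
by rewrite rmorphM fmorphV rmorphXn rmorph_nat [RHS]mulrAC mulrA.
Qed.

Lemma mul_hyper_besselE :
  (fun z => z * hyper_bessel alpha z) = csum c (fun n => (e n).+1).
Proof.
apply/funext => z; rewrite hyper_besselE.
by rewrite -(mul_csum c (fun n => (e n).+1) D 1) // => n; rewrite addn1.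
Qed.

Lemma derive1_mul_hyper_bessel :
  derive1 (fun z => z * hyper_bessel alpha z) = csum g e.
Proof.
have gE : (fun n => c n * (e n).+1%:R) = g.
  by apply/funext => n; rewrite mulrC -natr1 natrM addrC.
rewrite mul_hyper_besselE (derive1_csum _ _ D 1) ?gE //.
by move=> n; rewrite addn1.
Qed.

Lemma derive2_mul_hyper_bessel z :
  z * derive1n 2 (fun z => z * hyper_bessel alpha z) z =
    csum (fun n => g n * (e n)%:R) e z.
Proof.
rewrite derive1nS derive1n1 derive1_mul_hyper_bessel (derive1_csum _ _ D 0) //.
  by rewrite (mul_csum _ e D 0) // => [n|n ->]; rewrite ?addn0 ?mulr0.
by move=> n; rewrite addn0.
Qed.

(** With e = n D, the coefficients agree because 2 e (e - 1) + 5 e + 1 = (1 + e) (1 + 2 e).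
    Equivalently, the left side is f' + 2 z f''. *)
Lemma hyper_bessel_equationE z :
  2%:R * z ^+ 2 * derive1n 2 (hyper_bessel alpha) z
    + 5%:R * z * derive1 (hyper_bessel alpha) z + hyper_bessel alpha z
  = csum G e z.
Proof.
have he n : (e n <= n * D + 0)%N by rewrite addn0.
rewrite derive1nS derive1n1 hyper_besselE (derive1_csum _ _ D 0) //.
rewrite (derive1_csum _ _ D 0) //; last first.
  by move=> n; exact: leq_trans (leq_pred _) (he n).
have E1 : z * csum (fun n => c n * (e n)%:R) (fun n => (e n).-1) z
    = csum (fun n => c n * (e n)%:R) e z.
  by rewrite (mul_csum _ e D 0) // => n ->; rewrite mulr0.
have E2 : z ^+ 2 * csum (fun n => c n * (e n)%:R * (e n).-1%:R)
      (fun n => (e n).-1.-1) z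
    = csum (fun n => c n * (e n)%:R * (e n).-1%:R) e z.
  rewrite expr2 -mulrA (mul_csum _ (fun n => (e n).-1) D 0) //.
  - by rewrite (mul_csum _ e D 0) // => n ->; rewrite mulr0.
  - by move=> n; exact: leq_trans (leq_pred _) (he n).
  - by move=> n ->; rewrite mulr0.
rewrite -mulrA E2 -[5%:R * z * _]mulrA E1.
rewrite -[2%:R](rmorph_nat (real_complex R)).
rewrite -[5%:R](rmorph_nat (real_complex R)).
rewrite -!(csumZ _ e D 0) //.
have h2 := exp_dominatedZ _ 2%:R hcee; have h5 := exp_dominatedZ _ 5%:R hce.
have h25 := exp_dominatedD _ _ h2 h5.
rewrite -(csumD _ _ e D 0 z h2 h5 he) -(csumD _ _ e D 0 z h25 hc he).
congr csum; apply/funext => n; rewrite /G /g.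
have -> : (n * (2 * D) + 1)%:R = 2 * (e n)%:R + 1 :> R.
  by rewrite natrD mulnCA natrM.
rewrite -natrM -/(e n); case: (e n) => [|m]; first by rewrite !mulr0; ring.
by rewrite /= -natr1; ring.
Qed.

Lemma theta_csumE z : csum (fun n => g n * (e n)%:R) e z
  = D%:R * csum (fun n => n%:R * g n) id (z ^+ D).
Proof.
rewrite csum_comp -[D%:R](rmorph_nat (real_complex R)) -(csumZ _ id 1 0).
- by congr csum; apply/funext => n; rewrite /e natrM; ring.
- exact: exp_dominated_natM.
- by move=> n; rewrite muln1 addn0.
Qed.

Lemma rsum_convexity_coefE x : rsum G id x
  = rsum g id x + 2 * D%:R * rsum (fun n => n%:R * g n) id x.
Proof.
have hid n : (n <= n * 1 + 0)%N by rewrite muln1 addn0.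
have hng := exp_dominated_natM _ hg.
have hng' := exp_dominatedZ _ (2 * D%:R) hng.
apply: complexI; rewrite -(csum_real _ id 1 0 x convexity_coef_dominated hid).
rewrite (_ : G = fun n => g n + (2 * D%:R) * (n%:R * g n)); last first.
  by apply/funext => n; rewrite /G natrD !natrM; ring.
rewrite (csumD _ _ id 1 0 _ hg hng' hid) (csumZ _ id 1 0 _ _ hng hid).
by rewrite !(csum_real _ id 1 0) // rmorphD [X in _ = _ + X]rmorphM.
Qed.

(** * The least zero of G, and uniform convexity on discs *)

Lemma bessel_deriv_coef0 : g 0%N = 1.
Proof.
rewrite /g /bessel_deriv_coef /bessel_coef /hyper_bessel_coef.
rewrite mul0r addr0 mul1r mul0n expr0 fact0 expr0 big1 ?mulr1 ?divr1 //.
by move=> i _; rewrite /pochhammer big_ord0.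
Qed.

(** With p and q the products of the alpha_i + 1 and of the alpha_i + 2, the first claim reduces to
    (1 + 2 D) p < (1 + D)^2 q, which follows from 0 < p <= q. *)
Lemma bessel_deriv_coef_gap : 0 < g 1%N ^+ 2 - 2 * g 2%N /\ g 1%N < 0.
Proof.
set p := \prod_i (alpha i + 1); set q := \prod_i (alpha i + 1 + 1).
have p0 : 0 < p by apply: prodr_gt0.
have pq : p <= q.
  by apply: ler_prod => i _; rewrite ltW //= lerDl.
have q0 : 0 < q by apply: lt_le_trans pq.
set u : R := D%:R ^+ D; have u0 : 0 < u by rewrite exprn_gt0 // ltr0n.
have D1 : 1 <= D%:R :> R by rewrite ler1n.
have -> : g 1%N = - ((1 + D%:R) / (p * u)).
  rewrite /g /bessel_deriv_coef /bessel_coef /hyper_bessel_coef.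
  rewrite (eq_bigr (fun i => alpha i + 1)) => [|i _]; last first.
    by rewrite /pochhammer big_ord1 addr0.
  rewrite -/p mul1n -/u (_ : 1`! = 1%N) // expr1.
  by field; rewrite !gt_eqF.
have -> : g 2%N = (1 + 2 * D%:R) / (2 * (p * q) * u ^+ 2).
  rewrite /g /bessel_deriv_coef /bessel_coef /hyper_bessel_coef.
  under eq_bigr => i _ do
    rewrite /pochhammer !big_ord_recl big_ord0 mulr1 addr0 /=.
  rewrite big_split /= -/p -/q mulnC exprM -/u sqrrN expr1n (_ : 2`! = 2%N) //.
  by field; rewrite !gt_eqF.
split; last by rewrite oppr_lt0 divr_gt0 ?mulr_gt0 // ltr_wpDr.
rewrite sqrrN subr_gt0.
rewrite [ltLHS](_ : _ =
    ((1 + 2 * D%:R) * p) / (p ^+ 2 * q * u ^+ 2)); last first.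
  by field; rewrite !gt_eqF.
rewrite [ltRHS](_ : _ =
    ((1 + D%:R) ^+ 2 * q) / (p ^+ 2 * q * u ^+ 2)); last first.
  by field; rewrite !gt_eqF.
rewrite ltr_pM2r ?invr_gt0 ?mulr_gt0 ?exprn_gt0 //.
apply: (@lt_le_trans _ _ ((1 + D%:R) ^+ 2 * p)); last first.
  by rewrite ler_wpM2l // sqr_ge0.
by rewrite ltr_pM2r //; nra.
Qed.

(** If G stayed positive, so would g, and the third bound of [csum_disc] would hold for every rho
    although its right side tends to 0. *)
Lemma convexity_sum_least_zero : exists r, [/\ 0 < r, rsum G id r = 0 &
  forall x, 0 <= x < r -> 0 < rsum G id x].
Proof.
apply: rsum_least_zero.
- exact: convexity_coef_dominated.
- by rewrite /convexity_coef mul0n add0n mulr1 bessel_deriv_coef0.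
move=> Gpos; have [gap g1] := bessel_deriv_coef_gap.
(* Chosen so that - g_1 / rho is half of the positive quantity it should bound. *)
pose rho := 2 * - g 1%N / (g 1%N ^+ 2 - 2 * g 2%N).
have rho0 : 0 < rho by rewrite divr_gt0 // mulr_gt0 // oppr_gt0.
have gpos : forall x, 0 <= x <= rho -> 0 < rsum g id x.
  apply: (rsum_gt0_of_deriv _ (2 * D)) => //.
    by rewrite bessel_deriv_coef0.
  by move=> x /andP[x0 _]; exact: Gpos.
(* The third bound does not involve the point of the disc, so 0 serves. *)
have rhoC : `|0 : C| <= rho%:C%C by rewrite normr0 ler0c ltW.
have [_ _] := csum_disc g rho 0 bessel_deriv_limit rho0 gpos rhoC.
have -> : - g 1%N / rho = (g 1%N ^+ 2 - 2 * g 2%N) / 2.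
  by rewrite /rho; field; rewrite (gt_eqF gap) lt_eqF.
by apply/negP; rewrite -ltNge; lra.
Qed.

(** With q = z f'' / f', it suffices that |q| < 1/2, since then Re(1 + q) >= 1 - |q| > |q|. *)
Lemma uniformly_convex_below r : 0 < r ->
    (forall x, 0 <= x < r ^+ D -> 0 < rsum G id x) ->
  uniformly_convex_on_disc f r.
Proof.
move=> r0 Gpos z zr.
have [t t0 tE] := ge0_real_complex _ (normr_ge0 z).
have {zr}tr : t < r by move: zr; rewrite tE ltcR.
(* A radius below r and at least |z|, positive even for z = 0: [csum_disc] needs a closed disc. *)
pose y := (t + r) / 2.
have [ty yr y0] : [/\ t <= y, y < r & 0 < y] by rewrite /y; split; lra.
have X0 : 0 < y ^+ D by rewrite exprn_gt0.
have Xr : y ^+ D < r ^+ D by rewrite ltrXn2r ?nnegrE // ltW.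
have gpos : forall x, 0 <= x <= y ^+ D -> 0 < rsum g id x.
  apply: (rsum_gt0_of_deriv _ (2 * D)) => //.
    by rewrite bessel_deriv_coef0.
  by move=> x /andP[x0 xy]; apply: Gpos; rewrite x0 (le_lt_trans xy).
have zX : `|z ^+ D| <= (y ^+ D)%:C%C.
  by rewrite normrX tE -rmorphXn lecR lerXn2r ?nnegrE // ltW.
have [h1 h2 _] := csum_disc g _ _ bessel_deriv_limit X0 gpos zX.
have Gy : 0 < rsum G id (y ^+ D) by apply: Gpos; rewrite ltW.
have gy : 0 < rsum g id (y ^+ D) by apply: gpos; rewrite ltW /=.
move: Gy; rewrite rsum_convexity_coefE; move: gy h1 h2.
have -> : derive1 f z = csum g id (z ^+ D).
  by rewrite derive1_mul_hyper_bessel csum_comp.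
rewrite derive2_mul_hyper_bessel theta_csumE.
move: (rsum g id _) => g0; move: (rsum _ id _) => th.
move: (csum g id _) => gw; move: (csum _ id _) => tw.
have [A A0 AE] := ge0_real_complex _ (normr_ge0 gw).
have [B B0 BE] := ge0_real_complex _ (normr_ge0 tw).
rewrite AE BE -rmorphN -!rmorphM !lecR => gy h1 h2 Gy.
have A1 : 0 < A by exact: lt_le_trans h1.
have gw0 : gw != 0.
  rewrite -normr_eq0 AE -(rmorph0 (real_complex R)).
  by rewrite (inj_eq (@complexI R)) gt_eqF.
split => //.
(* With X = y^D this is D |w g'(w)| / |g(w)| <= - D X g'(X) / g(X) < 1/2, the last step being G(X) >
   0. *)
have key : 2 * D%:R * B < A.
  have D0 : 0 < D%:R :> R by rewrite ltr0n.
  rewrite -(ltr_pM2r gy); apply: (@le_lt_trans _ _ (2 * D%:R * (- th * A))).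
    by rewrite -(mulrA (2 * D%:R)) ler_wpM2l // mulr_ge0 // ltW.
  by rewrite mulrA [ltRHS]mulrC ltr_pM2r //; lra.
set q := _ / _.
have qE : `|q| = (D%:R * B / A)%:C%C.
  rewrite /q normrM normfV normrM normr_nat AE BE.
  by rewrite !rmorphM fmorphV rmorph_nat.
have q2 : `|q| < 1 - `|q|.
  rewrite qE -(rmorph1 (real_complex R)) -rmorphB ltcR.
  have : D%:R * B / A < 1 / 2 by rewrite ltr_pdivrMr //; lra.
  by lra.
apply: (lt_le_trans q2); rewrite raddfD /= (Creal_ReP 1 (rpred1 _)).
by rewrite lerD2l lerNl -raddfN -normrN; exact: (leif_Re_Creal (- q)).1.
Qed.

(** At z = r the equation G = 0 makes z f'' / f' equal to - 1/2, so both sides are 1/2 and the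
    strict inequality fails. The convexity condition itself supplies f'(r) != 0. *)
Lemma not_uniformly_convex_above r s : 0 < r -> r < s ->
  rsum G id (r ^+ D) = 0 -> ~ uniformly_convex_on_disc f s.
Proof.
move=> r0 rs Gr /(_ r%:C%C) [].
  by rewrite norm_real_complex gtr0_norm // ltcR.
have hid n : (n <= n * 1 + 0)%N by rewrite muln1 addn0.
rewrite derive2_mul_hyper_bessel theta_csumE.
have -> : derive1 f r%:C%C = (rsum g id (r ^+ D))%:C%C.
  rewrite derive1_mul_hyper_bessel csum_comp -rmorphXn.
  exact: csum_real hid.
rewrite -rmorphXn (csum_real _ id 1 0 _ (exp_dominated_natM _ hg) hid).
move: Gr; rewrite rsum_convexity_coefE.
move: (rsum g id _) => g0; move: (rsum _ id _) => th E g00.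
have {}g00 : g0 != 0 by apply: contraNneq g00 => ->.
have -> : D%:R * th%:C%C / g0%:C%C = (- (1 / 2))%:C%C.
  rewrite -[D%:R](rmorph_nat (real_complex R)) -fmorphV -!rmorphM.
  congr (_%:C%C); apply: (mulIf g00); rewrite divfK //; lra.
have -> : 1 + (- (1 / 2))%:C%C = (1 / 2)%:C%C :> R[i].
  rewrite -[1 in LHS](rmorph1 (real_complex R)) -rmorphD.
  by congr (_%:C%C); lra.
rewrite (Creal_ReP _ _); last by apply/complex_realP; eexists.
by rewrite norm_real_complex ltcR normrN ger0_norm //; lra.
Qed.
End HyperBessel.

(** * The radius of uniform convexity as a smallest root *)

Theorem theorem3 (R : realType) (d : nat) (alpha : 'I_d -> R)
    (hd : (1 <= d)%N) (halpha : forall i : 'I_d, -1 < alpha i) :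
  let J := hyper_bessel alpha in
  exists2 r : R,
    radius_uniform_convexity (fun z => z * J z) = r%:E &
    smallest_positive_root
      (fun z => 2%:R * z ^+ 2 * derive1n 2 J z + 5%:R * z * derive1 J z + J z) r.
Proof.
move=> J; have [rho [rho0 Grho Gpos]] := convexity_sum_least_zero alpha halpha.
(* The zero [rho] lives in the variable w = z^D. *)
have [r r0 rE] := ex_root rho d.+1 rho0 isT; exists r.
  apply/eqP; rewrite eq_le; apply/andP; split.
    apply: ge_ereal_sup => _ [s [s0 cvx] <-].
    rewrite lee_fin leNgt; apply/negP => rs.
    by apply: (not_uniformly_convex_above alpha halpha r s); rewrite ?rE.
  (* The disc is open, so r itself belongs to the set. *)
  apply: ereal_sup_ubound; exists r => //; split => //.
  by apply: uniformly_convex_below => //; rewrite rE.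
have FE (s : R) : 2%:R * (s%:C%C : Cplx R) ^+ 2 * derive1n 2 J s%:C%C +
    5%:R * s%:C%C * derive1 J s%:C%C + J s%:C%C =
  (rsum (convexity_coef alpha) id (s ^+ d.+1))%:C%C.
  rewrite /J (hyper_bessel_equationE alpha halpha) csum_comp -rmorphXn.
  apply: (csum_real _ id 1 0) => [|n]; last by rewrite muln1 addn0.
  exact: convexity_coef_dominated.
split => //; first by rewrite FE rE Grho.
move=> s s0; rewrite FE => /(@complexI R _ 0) Gs.
rewrite leNgt; apply/negP => sr.
have := Gpos (s ^+ d.+1); rewrite Gs ltxx -rE exprn_ge0 ?ltW //=.
by rewrite ltrXn2r ?nnegrE ?ltW // => /(_ isT).
Qed.
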